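(* Fix a context $c$ with authorization view $\mathcal A_c$. Every $(\varepsilon,\delta)$-differentially private mechanism is $(\varepsilon,\delta)$-contextually differentially private under $\mathcal A_c$. Moreover, let $\mathcal{M}_{\mathrm{syn}}$ be a randomized mechanism producing a synthetic database $\widetilde D=\mathcal{M}_{\mathrm{syn}}(D)$, let $f$ be a (possibly randomized) selection procedure that uses only $\widetilde D$ and public inputs and outputs a query $q^\star=f(\widetilde D)$ in a class $\mathcal Q$ of queries, and for each $q\in\mathcal Q$ let $\mathcal{M}_{\mathrm{rel}}(\cdot\,;q)$ be a randomized release mechanism. If $\mathcal{M}_{\mathrm{syn}}$ is $(\varepsilon_{\mathrm{syn}},\delta_{\mathrm{syn}})$-differentially private and $\mathcal{M}_{\mathrm{rel}}(\cdot\,;q)$ is $(\varepsilon_{\mathrm{rel}},\delta_{\mathrm{rel}})$-contextually differentially private under $\mathcal A_c$ for every $q\in\mathcal Q$, then the end-to-end mechanism $$\mathcal M(D)=\bigl(\widetilde D,\ \mathcal{M}_{\mathrm{rel}}(D;q^\star)\bigr)$$ is $(\varepsilon_{\mathrm{syn}}+\varepsilon_{\mathrm{rel}},\ \delta_{\mathrm{syn}}+\delta_{\mathrm{rel}})$-contextually differentially private under $\mathcal A_c$.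
   Context: $D\sim D'$ is the standard neighboring relation on databases (differing by one tuple in a private relation). For a fixed context $c$, $\mathcal A_c(D)$ denotes the information in $D$ that a policy authorizes to flow under $c$ (a fixed function of $D$). Contextual neighbors: $D\sim_c D'$ iff $D\sim D'$ and $\mathcal A_c(D)=\mathcal A_c(D')$. A randomized mechanism $\mathcal M$ is $(\varepsilon,\delta)$-differentially private (resp. $(\varepsilon,\delta)$-contextually differentially private under $\mathcal A_c$) if $\Pr[\mathcal M(D)\in O]\le e^{\varepsilon}\Pr[\mathcal M(D')\in O]+\delta$ for all measurable $O$ and all $D\sim D'$ (resp. all $D\sim_c D'$). The internal randomness of $\mathcal{M}_{\mathrm{syn}}$, $f$ and $\mathcal{M}_{\mathrm{rel}}$ is mutually independent. *)

(* Defs.v *)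
From HB Require Import structures.
From mathcomp Require Import all_boot all_order all_algebra.
From mathcomp Require Import finmap multiset.
From mathcomp Require Import all_classical all_reals all_analysis.

Set Implicit Arguments.
Unset Strict Implicit.
Unset Printing Implicit Defensive.

Local Open Scope classical_set_scope.
Local Open Scope ring_scope.

Record schema := Schema {
  relation_name : finType;
  tuple_type : relation_name -> choiceType;
  is_private : pred relation_name
}.

(* Relations have bag semantics. *)
Definition database (S : schema) : Type :=
  forall r : relation_name S, {mset tuple_type r}%mset.

HB.instance Definition _ (S : schema) := gen_eqMixin (database S).
HB.instance Definition _ (S : schema) := gen_choiceMixin (database S).
HB.instance Definition _ (S : schema) :=
  isPointed.Build (database S) (fun r => mset0).

(* The two usual meanings of "differing by one tuple": one relation has one
   tuple more than the other, or one tuple is replaced by a different one. *)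
Inductive tuple_change := AddRemove | Substitute.

Definition differ_by_one_tuple (k : tuple_change) (T : choiceType)
    (A B : {mset T}%mset) : Prop :=
  match k with
  | AddRemove =>
      exists t : T, A = msetD (msetn 1 t) B \/ B = msetD (msetn 1 t) A
  | Substitute =>
      exists (E : {mset T}%mset) (t u : T),
        [/\ t <> u, A = msetD (msetn 1 t) E & B = msetD (msetn 1 u) E]
  end.

Definition neighbors (k : tuple_change) (S : schema) (D D' : database S) : Prop :=
  exists r : relation_name S,
    [/\ is_private r, differ_by_one_tuple k (D r) (D' r) &
        forall s : relation_name S, s <> r -> D s = D' s].

Definition contextual_neighbors (k : tuple_change) (S : schema) (V : Type)
    (Ac : database S -> V) (D D' : database S) : Prop :=
  neighbors k D D' /\ Ac D = Ac D'.

Section privacy.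
Context {R : realType} {S : schema} {dO : measure_display}
  {Omega : measurableType dO} {P : probability Omega R}
  {dY : measure_display} {Y : measurableType dY}.

(* A randomized mechanism is a family of random elements indexed by the input
   database. *)
Definition private_wrt (nbr : database S -> database S -> Prop) (eps delta : R)
    (M : database S -> {RV P >-> Y}) : Prop :=
  forall D D' : database S, nbr D D' ->
  forall O : set Y, measurable O ->
    (P (M D @^-1` O) <= (expR eps)%:E * P (M D' @^-1` O) + delta%:E)%E.

Definition differentially_private (k : tuple_change) :=
  private_wrt (@neighbors k S).

Definition contextually_differentially_private (k : tuple_change) (V : Type)
    (Ac : database S -> V) :=
  private_wrt (contextual_neighbors k Ac).

End privacy.

(* Allowing the full sets among A, B, C gives the product rule for every
   subfamily. *)
Definition mutually_independent {R : realType} {dO d1 d2 d3 : measure_display}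
    {Omega : measurableType dO} {P : probability Omega R}
    {T1 : measurableType d1} {T2 : measurableType d2} {T3 : measurableType d3}
    (X : {RV P >-> T1}) (Y : {RV P >-> T2}) (Z : {RV P >-> T3}) : Prop :=
  forall (A : set T1) (B : set T2) (C : set T3),
    measurable A -> measurable B -> measurable C ->
    P (X @^-1` A `&` Y @^-1` B `&` Z @^-1` C) =
      (P (X @^-1` A) * P (Y @^-1` B) * P (Z @^-1` C))%E.

(* The mechanisms are deterministic functions of their input and of a random
   seed: wsyn, wf and wrel are the internal randomness of msyn, f and mrel. The
   joint measurability of f and mrel makes the composition a random element. *)
Section pipeline.
Context {R : realType} {S : schema} {dO : measure_display}
  {Omega : measurableType dO} {P : probability Omega R}
  {dws dwf dwr dD dQ dZ : measure_display}
  {Ws : measurableType dws} {Wf : measurableType dwf} {Wr : measurableType dwr}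
  {Db : measurableType dD} {Q : measurableType dQ} {Z : measurableType dZ}.
Variables (wsyn : {RV P >-> Ws}) (wf : {RV P >-> Wf}) (wrel : {RV P >-> Wr}).
Variables (msyn : database S -> {mfun Ws >-> Db}) (f : {mfun (Db * Wf)%type >-> Q})
  (mrel : database S -> {mfun (Q * Wr)%type >-> Z}).

Definition synthetic_database (D : database S) : Omega -> Db :=
  fun w => msyn D (wsyn w).

Definition selected_query (D : database S) : Omega -> Q :=
  fun w => f (synthetic_database D w, wf w).

Definition release (q : Q) (D : database S) : Omega -> Z :=
  fun w => mrel D (q, wrel w).

Definition end_to_end (D : database S) : Omega -> Db * Z :=
  fun w => (synthetic_database D w, release (selected_query D w) D w).

Let measurable_synthetic_database D :
  measurable_fun setT (synthetic_database D).
Proof. exact: measurableT_comp. Qed.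

HB.instance Definition _ D := isMeasurableFun.Build _ _ _ _
  (synthetic_database D) (measurable_synthetic_database D).

Let measurable_selected_query D : measurable_fun setT (selected_query D).
Proof.
apply: (@measurableT_comp _ _ _ _ _ _ f) => //.
exact: measurable_fun_pair.
Qed.

HB.instance Definition _ D := isMeasurableFun.Build _ _ _ _
  (selected_query D) (measurable_selected_query D).

Let measurable_release q D : measurable_fun setT (release q D).
Proof.
apply: (@measurableT_comp _ _ _ _ _ _ (mrel D)) => //.
exact: measurable_fun_pair.
Qed.

HB.instance Definition _ q D := isMeasurableFun.Build _ _ _ _
  (release q D) (measurable_release q D).

Let measurable_end_to_end D : measurable_fun setT (end_to_end D).
Proof.
apply: measurable_fun_pair => //.
apply: (@measurableT_comp _ _ _ _ _ _ (mrel D)) => //.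
exact: measurable_fun_pair.
Qed.

HB.instance Definition _ D := isMeasurableFun.Build _ _ _ _
  (end_to_end D) (measurable_end_to_end D).

End pipeline.

(* Main.v *)
Require Import Defs.
(* By independence, the probability that the pipeline lands in O is the
   integral, over the joint law of the synthetic database and the randomness of
   f, of the probability that the release lands in the section of O. On D this
   inner probability is at most g + delta_rel, where g is the minimum of 1 and
   e^eps_rel times the inner probability on D'. Since 0 <= g <= 1, the layer-cake
   formula transfers the guarantee of the synthesizer from events to the
   expectation of g; truncating at 1 keeps delta_syn from being multiplied by
   e^eps_rel. *)

From HB Require Import structures.
From mathcomp Require Import all_boot all_order all_algebra.
From mathcomp Require Import all_classical all_reals all_analysis.
From mathcomp Require Import measurable_realfun lra.

Set Implicit Arguments.
Unset Strict Implicit.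
Unset Printing Implicit Defensive.

Import Order.TTheory GRing.Theory Num.Theory.

Local Open Scope classical_set_scope.
Local Open Scope ring_scope.

(** * Product measures and laws of independent pairs *)

Section pairing.
Context {dO d1 d2 : measure_display} {Omega : measurableType dO}
  {R : realType} {P : probability Omega R}
  {T1 : measurableType d1} {T2 : measurableType d2}.

Definition pair_rv (X : {RV P >-> T1}) (Y : {RV P >-> T2}) (w : Omega) :
  T1 * T2 := (X w, Y w).

Lemma measurable_pair_rv X Y : measurable_fun setT (pair_rv X Y).
Proof. exact: measurable_fun_pair. Qed.

HB.instance Definition _ X Y := isMeasurableFun.Build _ _ _ _
  (pair_rv X Y) (measurable_pair_rv X Y).

Definition independent (X : {RV P >-> T1}) (Y : {RV P >-> T2}) : Prop :=
  forall A B, measurable A -> measurable B ->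
    P (X @^-1` A `&` Y @^-1` B) = (P (X @^-1` A) * P (Y @^-1` B))%E.

(** Measurable rectangles are closed under intersection and generate the product sigma-algebra.
    Total mass is only required to be finite, since the lemma serves for a law restricted to an
    event. *)
Lemma finite_measure_prod_unique (m m' : {measure set (T1 * T2) -> \bar R}) :
  (m setT < +oo)%E ->
  (forall A B, measurable A -> measurable B -> m (A `*` B) = m' (A `*` B)) ->
  forall E, measurable E -> m E = m' E.
Proof.
move=> moo mm'; apply: (measure_unique
  [set A `*` B | A in measurable & B in measurable] (fun=> setT)) => //.
- exact: measurable_prod_measurableType.
- move=> _ _ [A mA [B mB <-]] [A' mA' [B' mB' <-]]; rewrite -setXI.
  exists (A `&` A'); first exact: measurableI.
  by exists (B `&` B') => //; exact: measurableI.
- by move=> _; exists setT => //; exists setT => //; rewrite setXTT.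
- by rewrite bigcup_const.
- by move=> _ [A mA [B mB <-]]; exact: mm'.
Qed.

(** Independence says that the joint law agrees with the product of the laws on rectangles, hence
    everywhere; the product measure is by definition an integral of sections. *)
Lemma independent_pair_integral (X : {RV P >-> T1}) (Y : {RV P >-> T2}) E :
  independent X Y -> measurable E ->
  P (pair_rv X Y @^-1` E) = (\int[P]_w P (Y @^-1` xsection E (X w)))%E.
Proof.
move=> XY mE; transitivity ((distribution P X \x distribution P Y)%E E).
  apply/esym/(@product_measure_unique _ _ _ _ _ _ _
    (distribution P (pair_rv X Y))) => //.
rewrite /product_measure1 ge0_integral_distribution//.
exact: (measurable_fun_xsection (distribution P Y)).
Qed.

End pairing.

(** * From three mutually independent elements to two *)

Section triple.
Context {dO d1 d2 d3 : measure_display} {Omega : measurableType dO}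
  {R : realType} {P : probability Omega R}
  {T1 : measurableType d1} {T2 : measurableType d2} {T3 : measurableType d3}
  {X : {RV P >-> T1}} {Y : {RV P >-> T2}} {Z : {RV P >-> T3}}.

Lemma mutually_independent_12 : mutually_independent X Y Z -> independent X Y.
Proof.
move=> XYZ A B mA mB.
have := XYZ A B setT mA mB measurableT.
by rewrite preimage_setT setIT probability_setT mule1.
Qed.

(** For a fixed event on [Z], both sides of the product rule are finite measures in the event on the
    pair: [m] is the law of the pair restricted to that event, [m'] the law of the pair scaled by
    its probability. Mutual independence equates them on rectangles. *)
Lemma mutually_independent_pair :
  mutually_independent X Y Z -> independent (pair_rv X Y) Z.
Proof.
move=> XYZ A C mA mC.
have mZC : measurable (Z @^-1` C) by exact: measurable_funPTI.
have cfin : P (Z @^-1` C) \is a fin_num by exact: fin_num_measure.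
have c0 : 0 <= fine (P (Z @^-1` C)) by exact: fine_ge0.
pose m := pushforward (mrestr P mZC) (pair_rv X Y).
pose m' := mscale (NngNum c0) (distribution P (pair_rv X Y)).
have m'E B : m' B = (P (Z @^-1` C) * P (pair_rv X Y @^-1` B))%E.
  by rewrite /m' /mscale /= fineK.
suff : m A = m' A by rewrite m'E muleC.
apply: finite_measure_prod_unique => //.
  change (P (setT `&` Z @^-1` C) < +oo)%E.
  by rewrite setTI -ge0_fin_numE.
move=> B D mB mD; rewrite -[RHS]/(m' _) m'E.
by rewrite [LHS]XYZ// muleC -(mutually_independent_12 XYZ).
Qed.

End triple.

(** * The privacy inequality, from events to expectations *)

Section approximate_domination.
Context {dO d : measure_display} {Omega : measurableType dO}
  {R : realType} {P : probability Omega R} {T : measurableType d}.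

(** This is the inequality of [private_wrt] for a single pair of outputs, freed from databases. *)
Definition dominated (eps delta : R) (X X' : {RV P >-> T}) : Prop :=
  forall O, measurable O ->
    (P (X @^-1` O) <= (expR eps)%:E * P (X' @^-1` O) + delta%:E)%E.

Lemma dominated_ge0 eps delta X X' : dominated eps delta X X' -> 0 <= delta.
Proof.
move=> /(_ set0 measurable0).
by rewrite !preimage_set0 !measure0 mule0 add0e lee_fin.
Qed.

Lemma dominated_expectation eps delta X X' (g : {mfun T >-> R}) :
  dominated eps delta X X' -> (forall x, 0 <= g x <= 1) ->
  ('E_P[g \o X] <= (expR eps)%:E * 'E_P[g \o X'] + delta%:E)%E.
Proof.
move=> XX' g01; have d0 := dominated_ge0 XX'.
have g0 x : 0 <= g x by case/andP: (g01 x).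
rewrite !ge0_expectation_ccdf; [|by move=> w /=..].
pose D : set R := `[0, +oo[%classic.
rewrite -/D.
have mD : measurable D by exact: measurable_itv.
(* [h] spreads [delta] over the levels in [[0, 1]], an interval of length 1, so its integral is
   [delta] and the two layer-cake integrands can be compared pointwise. *)
pose h := fun r : R => (delta%:E * (\1_(`[0, 1] : set R) r)%:E)%E.
have h0 r : (0 <= h r)%E by rewrite mule_ge0 ?lee_fin.
have mh : measurable_fun D h.
  apply: measurable_funTS; apply: measurable_funeM; apply/measurable_EFinP.
  exact: measurable_indic.
have mc Z : measurable_fun D (ccdf (P := P) Z).
  by apply: measurable_funTS; exact: ccdf_measurable.
have -> : delta%:E = (\int[lebesgue_measure]_(r in D) h r)%E.
  have mI : measurable_fun D (fun r => (\1_(`[0, 1] : set R) r : R)%:E).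
    by apply: measurable_funTS; apply/measurable_EFinP; exact: measurable_indic.
  rewrite ge0_integralZl_EFin//.
  rewrite integral_indic// setIidl; last first.
    by move=> r; rewrite /D/= !in_itv/= andbT => /andP[].
  by rewrite /= lebesgue_measure_itv/= lte_fin ltr01 oppr0 adde0 mule1.
have ec0 Z r : D r -> (0 <= (expR eps)%:E * ccdf (P := P) Z r)%E.
  by move=> _; rewrite mule_ge0 ?lee_fin ?expR_ge0 ?measure_ge0.
have mec Z : measurable_fun D (fun r => (expR eps)%:E * ccdf (P := P) Z r)%E.
  exact: measurable_funeM.
rewrite -ge0_integralZl_EFin ?expR_ge0 -?ge0_integralD//; first last.
- exact: mc.
- exact: mec.
- exact: ec0.
apply: ge0_le_integral => //.
- exact: mc.
- by apply: emeasurable_funD; [exact: mec|exact: mh].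
- move=> r; rewrite /D/= in_itv/= andbT => r0.
  have mg : measurable (g @^-1` `]r, +oo[) by exact: measurable_funPTI.
  have [r1|r1] := leP r 1.
    rewrite /h indicE mem_set ?mule1; last by rewrite /= in_itv/= r0.
    exact: (XX' _ mg).
  (* Above level 1, [h] contributes nothing, but [g] never exceeds 1 and the left side vanishes. *)
  have gr : g @^-1` `]r, +oo[ = set0.
    apply/seteqP; split => // x; rewrite /= in_itv/= andbT => rgx.
    by have /andP[_] := g01 x; lra.
  rewrite /ccdf /distribution /pushforward /= comp_preimage gr preimage_set0.
  rewrite measure0.
  by rewrite adde_ge0// mule_ge0 ?lee_fin ?expR_ge0 ?measure_ge0.
Qed.

End approximate_domination.

(** * Composition of two privacy guarantees *)

Section adaptive_composition.
Context {dO d1 d2 : measure_display} {Omega : measurableType dO}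
  {R : realType} {P : probability Omega R}
  {T1 : measurableType d1} {T2 : measurableType d2}.

(** Two events [E] and [E'] are allowed because the same output event pulls back to different sets
    of seeds when the mechanism depends on the database. *)
Lemma adaptive_composition eps1 delta1 eps2 delta2 (X X' : {RV P >-> T1})
    (Y Y' : {RV P >-> T2}) (E E' : set (T1 * T2)) :
  measurable E -> measurable E' -> independent X Y -> independent X' Y' ->
  dominated eps1 delta1 X X' -> 0 <= delta2 ->
  (forall x, P (Y @^-1` xsection E x) <=
    (expR eps2)%:E * P (Y' @^-1` xsection E' x) + delta2%:E)%E ->
  (P (pair_rv X Y @^-1` E) <=
    (expR (eps1 + eps2))%:E * P (pair_rv X' Y' @^-1` E')
      + (delta1 + delta2)%:E)%E.
Proof.
move=> mE mE' XY XY' XX' d2_ge0 sec.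
rewrite !independent_pair_integral//.
have mk := measurable_fun_xsection (distribution P Y) mE.
have mk' := measurable_fun_xsection (distribution P Y') mE'.
pose k' x := P (Y' @^-1` xsection E' x).
have mY' x : measurable (Y' @^-1` xsection E' x).
  by apply: measurable_funPTI; exact: measurable_xsection.
have k'fin x : k' x \is a fin_num by exact: fin_num_measure.
pose g x := Num.min 1 (expR eps2 * fine (k' x)).
have mg : measurable_fun setT g.
  apply: measurable_minr => //; apply: measurable_funM => //.
  by apply: measurableT_comp mk' => //; exact: measurable_fine.
pose G : {mfun T1 >-> R} := mfun_Sub (mem_set mg).
have G01 x : 0 <= G x <= 1.
  rewrite /= ge_min lexx andbT le_min ler01 mulr_ge0 ?expR_ge0//.
  exact/fine_ge0/measure_ge0.
have G_int := dominated_expectation XX' G01.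
have GX0 x : (0 <= (G x)%:E)%E by rewrite lee_fin; case/andP: (G01 x).
have mGX (Z : {RV P >-> T1}) : measurable_fun setT (fun w => (G (Z w))%:E).
  apply/measurable_EFinP; exact: measurableT_comp.
have kG x : (P (Y @^-1` xsection E x) <= (G x)%:E + delta2%:E)%E.
  have mY : measurable (Y @^-1` xsection E x).
    by apply: measurable_funPTI; exact: measurable_xsection.
  (* Where the truncation is active, the bound is at least 1 and holds for any probability;
     elsewhere it is the hypothesis [sec]. *)
  have [le1|le1] := leP 1 (expR eps2 * fine (k' x)).
    rewrite /= /g; move/min_idPl: le1 => ->.
    by rewrite (le_trans (probability_le1 P mY))// leeDl ?lee_fin.
  rewrite /= /g; move/ltW/min_idPr: le1 => ->.
  by rewrite EFinM fineK//; exact: sec.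
have step1 : (\int[P]_w P (Y @^-1` xsection E (X w)) <=
    'E_P[G \o X] + delta2%:E)%E.
  rewrite expectation_def.
  have -> : delta2%:E = (\int[P]_w (cst delta2%:E) w)%E.
    by rewrite integral_cst//= probability_setT mule1.
  rewrite -ge0_integralD//.
  apply: ge0_le_integral => //.
  - exact: measurableT_comp mk _.
  - by apply: emeasurable_funD => //; exact: mGX.
  - by move=> w _; exact: GX0.
  - exact: mGX.
have mk'X : measurable_fun setT (fun w => k' (X' w)).
  exact: measurableT_comp mk' _.
have step2 : ('E_P[G \o X'] <= (expR eps2)%:E * \int[P]_w k' (X' w))%E.
  rewrite expectation_def -ge0_integralZl ?lee_fin ?expR_ge0//.
  apply: ge0_le_integral => //.
  - by move=> w _; exact: GX0.
  - exact: mGX.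
  - exact: measurable_funeM.
  - move=> w _.
    by rewrite -(fineK (k'fin _)) -EFinM lee_fin /= ge_min lexx orbT.
rewrite (le_trans step1)// EFinD addeA leeD2r// (le_trans G_int)// leeD2r//.
by rewrite expRD EFinM -muleA lee_wpmul2l// lee_fin expR_ge0.
Qed.

(** This attaches the seed of the selection procedure to the synthetic database at no privacy
    cost. *)
Lemma dominated_pair eps delta (X : {RV P >-> T1}) (Y Y' : {RV P >-> T2}) :
  independent X Y -> independent X Y' -> dominated eps delta Y Y' ->
  dominated (P := P) eps delta (pair_rv Y X) (pair_rv Y' X).
Proof.
move=> XY XY' YY' E mE.
have mE' : measurable ((fun z : T1 * T2 => (z.2, z.1)) @^-1` E).
  rewrite -[X in measurable X]setTI.
  suff mh : measurable_fun setT (fun z : T1 * T2 => (z.2, z.1)) by exact: mh.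
  exact: measurable_fun_pair.
rewrite -[eps]add0r -[delta]add0r.
(* The shared component [X] goes first, where it is dominated by itself. *)
apply: (adaptive_composition mE' mE' XY XY').
- by move=> A _; rewrite expR0 mul1e adde0.
- exact: dominated_ge0 YY'.
- by move=> x; apply: YY'; exact: measurable_xsection.
Qed.

End adaptive_composition.

Theorem corollary1 (R : realType) (S : schema) (k : tuple_change)
    (Ctx V : Type) (A : Ctx -> database S -> V) (c : Ctx) :
  (forall (dO dY : measure_display) (Omega : measurableType dO)
      (P : probability Omega R) (Y : measurableType dY)
      (M : database S -> {RV P >-> Y}) (eps delta : R),
    differentially_private k eps delta M ->
    contextually_differentially_private k (A c) eps delta M) /\
  (forall (dO dws dwf dwr dQ dZ : measure_display)
      (Omega : measurableType dO) (P : probability Omega R)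
      (Ws : measurableType dws) (Wf : measurableType dwf)
      (Wr : measurableType dwr)
      (wsyn : {RV P >-> Ws}) (wf : {RV P >-> Wf}) (wrel : {RV P >-> Wr})
      (G : set (set (database S)))
      (Q : measurableType dQ) (Z : measurableType dZ) (Pub : Type) (pub : Pub)
      (msyn : database S -> {mfun Ws >-> g_sigma_algebraType G})
      (f : Pub -> {mfun (g_sigma_algebraType G * Wf)%type >-> Q})
      (mrel : database S -> {mfun (Q * Wr)%type >-> Z})
      (eps_syn delta_syn eps_rel delta_rel : R),
    mutually_independent wsyn wf wrel ->
    differentially_private k eps_syn delta_syn
      (fun D => synthetic_database wsyn msyn D : {RV P >-> _}) ->
    (forall q : Q,
      contextually_differentially_private k (A c) eps_rel delta_rel
        (fun D => release wrel mrel q D : {RV P >-> _})) ->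
    contextually_differentially_private k (A c)
      (eps_syn + eps_rel) (delta_syn + delta_rel)
      (fun D => end_to_end wsyn wf wrel msyn (f pub) mrel D : {RV P >-> _})).
Proof.
split=> [dO dY Omega P Y M eps delta dpM D D' [DD' _]|]; first exact: dpM.
move=> dO dws dwf dwr dQ dZ Omega P Ws Wf Wr wsyn wf wrel G Q Z Pub pub.
move=> msyn f mrel eps_syn delta_syn eps_rel delta_rel ind syn_dp rel_cdp.
move=> D D' DD' O mO.
pose syn B : {RV P >-> _} := synthetic_database wsyn msyn B.
have ind_syn B : mutually_independent (syn B) wf wrel.
  move=> A1 A2 A3 mA1 mA2 mA3.
  (* An event on the synthetic database is an event on the seed [wsyn]. *)
  by apply: (ind (msyn B @^-1` A1)) => //; exact: measurable_funPTI.
have syn_wf_dominated : dominated (P := P) eps_syn delta_syn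
    (pair_rv (syn D) wf) (pair_rv (syn D') wf).
  have ind_wf B : independent wf (syn B).
    move=> A1 A2 mA1 mA2; rewrite setIC muleC.
    exact: (mutually_independent_12 (ind_syn B)).
  exact: (dominated_pair (ind_wf D) (ind_wf D') (syn_dp D D' DD'.1)).
(* Here [z.1] holds the synthetic database and the seed of [f], and [z.2] the seed of the
   release. *)
pose E B := [set z | O (z.1.1, mrel B (f pub z.1, z.2))].
have mE B : measurable (E B).
  rewrite -[X in measurable X]setTI.
  suff mh : measurable_fun setT
      (fun z => (z.1.1, mrel B (f pub z.1, z.2))) by exact: mh.
  apply: measurable_fun_pair; first exact: measurableT_comp.
  apply: (@measurableT_comp _ _ _ _ _ _ (mrel B)) => //.
  apply: measurable_fun_pair => //.
  by apply: (@measurableT_comp _ _ _ _ _ _ (f pub)).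
apply: (adaptive_composition (mE D) (mE D')
  (mutually_independent_pair (ind_syn D))
  (mutually_independent_pair (ind_syn D'))
  syn_wf_dominated).
(* Any single query yields the sign of [delta_rel]; [point] is the default one. *)
- exact: dominated_ge0 (rel_cdp point D D' DD').
(* Once [z] is fixed, so is the query, and the section of [E B] is the event that its release lands
   in the section of [O] at [z.1]. *)
- move=> z; have := rel_cdp (f pub z) D D' DD' _ (measurable_xsection z.1 mO).
  by rewrite !xsectionE.
Qed.
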